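(* Let $k,n\ge 1$ be integers, and consider the planar polynomial system (with a fixed choice of sign, the same in both equations) $$ \begin{array}{rcl} \dot x&=&-y^{2n-1}\pm x^n y^{n-1}\,(x^{2n}+y^{2n})^k,\\ \dot y&=&\phantom{-}x^{2n-1}\pm x^{n-1} y^n\,(x^{2n}+y^{2n})^k. \end{array} $$ Let $\Gamma\subset\mathbb{R}^2$ be a spiral trajectory of this system near the focus at the origin. Then $$ \dim_B\Gamma=2-\frac{2}{1+2kn}, $$ and $\Gamma$ is Minkowski nondegenerate.
   Context: Spiral trajectory near the focus: the origin is a singular point of focus type, and $\Gamma$ is a nonconstant half-trajectory, contained in a bounded neighbourhood of the origin, which converges to the origin (as time tends to $+\infty$ or to $-\infty$) while winding around it infinitely many times. Box dimension. For a bounded set $A\subset\mathbb{R}^N$ (here $N=2$) and $\varepsilon>0$, let $A_\varepsilon:=\{y\in\mathbb{R}^N : d(y,A)<\varepsilon\}$ and let $|A_\varepsilon|$ be its $N$-dimensional Lebesgue measure. For $s\ge 0$ the lower and upper $s$-dimensional Minkowski contents are $$\mathcal{M}_*^s(A):=\liminf_{\varepsilon\to0}\frac{|A_\varepsilon|}{\varepsilon^{N-s}},\qquad \mathcal{M}^{*s}(A):=\limsup_{\varepsilon\to0}\frac{|A_\varepsilon|}{\varepsilon^{N-s}}.$$ The lower and upper box dimensions are $\underline{\dim}_BA:=\inf\{s\ge0:\mathcal{M}_*^s(A)=0\}$ and $\overline{\dim}_BA:=\inf\{s\ge0:\mathcal{M}^{*s}(A)=0\}$. If they coincide, the common value is the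 box dimension $\dim_BA$. The set $A$ is Minkowski nondegenerate if $0<\mathcal{M}_*^d(A)\le\mathcal{M}^{*d}(A)<\infty$ for some $d$ (in which case $d=\dim_BA$). *)

(* Defs.v *)
From HB Require Import structures.
From mathcomp Require Import all_boot all_order all_algebra.
From mathcomp Require Import all_classical all_reals all_analysis.

Set Implicit Arguments.
Unset Strict Implicit.
Unset Printing Implicit Defensive.

Import Order.TTheory GRing.Theory Num.Theory.
Import numFieldNormedType.Exports.

Local Open Scope classical_set_scope.
Local Open Scope ring_scope.

Section Minkowski.
Context {R : realType}.
Implicit Types (A : set (R * R)) (s d eps : R).

(* The norm of the library on R * R is the sup norm, hence these. *)
Definition eucl_norm (p : R * R) : R := Num.sqrt (p.1 ^+ 2 + p.2 ^+ 2).

Definition eucl_dist (p q : R * R) : R := eucl_norm (p - q).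

(* Extended-real valued, so that the distance to the empty set is +oo. *)
Definition dist_to_set (p : R * R) A : \bar R :=
  ereal_inf [set (eucl_dist p a)%:E | a in A].

Definition neighborhood A eps : set (R * R) :=
  [set p | (dist_to_set p A < eps%:E)%E].

Definition area A : \bar R :=
  ((@lebesgue_measure R) \x (@lebesgue_measure R))%E A.

Definition content_ratio s A eps : \bar R :=
  (area (neighborhood A eps) / (eps `^ (2 - s))%:E)%E.

Definition lower_content s A : \bar R := limf_einf (content_ratio s A) (0^'+).

Definition upper_content s A : \bar R := limf_esup (content_ratio s A) (0^'+).

Definition lower_box_dim A : \bar R :=
  ereal_inf [set s%:E | s in [set s | 0 <= s /\ lower_content s A = 0%E]].

Definition upper_box_dim A : \bar R :=
  ereal_inf [set s%:E | s in [set s | 0 <= s /\ upper_content s A = 0%E]].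

Definition has_box_dim A d : Prop :=
  lower_box_dim A = d%:E /\ upper_box_dim A = d%:E.

Definition minkowski_nondegenerate A : Prop :=
  exists d, [/\ 0 <= d, (0 < lower_content d A)%E,
    (lower_content d A <= upper_content d A)%E
    & (upper_content d A < +oo)%E].

End Minkowski.

Section Trajectories.
Context {R : realType}.
Implicit Types (V : R * R -> R * R) (I : set R) (g : R -> R * R).

Definition half_line (fwd : bool) (t0 : R) : set R :=
  if fwd then [set` `[t0, +oo[] else [set` `]-oo, t0]].

Definition time_end (fwd : bool) : set_system R :=
  if fwd then pinfty_nbhs R else ninfty_nbhs R.

(* Two-sided derivatives at every point of I, end-points included: a half
   trajectory is a piece of a solution that extends beyond its initial point. *)
Definition solution_on V I g : Prop :=
  forall t, I t -> is_derive t 1 g (V (g t)).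

(* Infinite winding: the absolute value of a continuous determination theta
   of the polar angle along g tends to infinity. *)
Definition spirals_to_origin (fwd : bool) (t0 : R) g : Prop :=
  g @ time_end fwd --> ((0, 0) : R * R) /\
  exists theta : R -> R,
    [/\ {within half_line fwd t0, continuous theta},
        forall t, half_line fwd t0 t ->
          g t = (eucl_norm (g t) * cos (theta t), eucl_norm (g t) * sin (theta t))
      & (fun t => `|theta t|) @ time_end fwd --> +oo].

(* The origin is a stable (fwd = true) or unstable (fwd = false) focus. For a
   smooth V the solution through p is unique, so that the existential below
   speaks about the trajectory of p. *)
Definition focus_at_origin V : Prop :=
  V (0, 0) = (0, 0) /\
  exists (fwd : bool) (r : R), 0 < r /\
    forall p, 0 < eucl_norm p < r ->
      exists g, [/\ g 0 = p, solution_on V (half_line fwd 0) g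
                  & spirals_to_origin fwd 0 g].

Definition spiral_trajectory V (Gamma : set (R * R)) : Prop :=
  focus_at_origin V /\
  exists (fwd : bool) (t0 : R) g,
    [/\ solution_on V (half_line fwd t0) g,
        exists t1 t2, [/\ half_line fwd t0 t1, half_line fwd t0 t2
                        & g t1 <> g t2],
        Gamma = g @` half_line fwd t0,
        bounded_set Gamma
      & spirals_to_origin fwd t0 g].

(* The choice of sign is (-1) ^+ sg: plus if sg = false, minus if sg = true. *)
Definition vector_field (k n : nat) (sg : bool) (p : R * R) : R * R :=
  let x := p.1 in
  let y := p.2 in
  (- y ^+ (2 * n - 1)
     + (-1) ^+ sg * (x ^+ n * y ^+ (n - 1) * (x ^+ (2 * n) + y ^+ (2 * n)) ^+ k),
   x ^+ (2 * n - 1)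
     + (-1) ^+ sg * (x ^+ (n - 1) * y ^+ n * (x ^+ (2 * n) + y ^+ (2 * n)) ^+ k)).

End Trajectories.

(* Main.v *)
Require Import Defs.
From mathcomp Require Import all_boot all_order all_algebra.
From mathcomp Require Import all_classical all_reals all_analysis.
From mathcomp Require Import ring lra.

Set Implicit Arguments.
Unset Strict Implicit.
Unset Printing Implicit Defensive.

Import Order.TTheory GRing.Theory Num.Theory.
Import numFieldNormedType.Exports.

Local Open Scope classical_set_scope.
Local Open Scope ring_scope.

(** Put h = x^(2n) + y^(2n), X = x^n and Y = y^n, and let s be the sign in the
system.  Along a trajectory
      h' = 2ns (xy)^(n-1) h^(k+1),      x y' - y x' = h,
and (X, Y) turns around the origin with angular velocity n (xy)^(n-1).  Hence
w = h^(-k) satisfies w' = -2nks (xy)^(n-1), a constant multiple of the angular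
velocity of (X, Y): in the coordinates (X, Y) the system is integrated by
      (X, Y) = w^(-1/(2k)) (cos, sin)(const - s w/(2k)).

If n is even, (X, Y) stays in the closed first quadrant, so its angle, and with
it w, is bounded: no trajectory tends to the origin, which therefore is not a
focus ([focus_exponent_even]).  If n is odd, (x, y) and (X, Y) determine each
other and lie in the same quadrant, so the polar angles of both differ by a
bounded amount, and the trajectory is comparable with the power spiral
r = phi^(-1/m), where m = 2nk.  As w must increase to infinity, s is opposite to
the direction of time ([focus_sign]).

It remains to show that the area of the eps-neighbourhood is of exact order e^2,
where eps = e^(m+1): since e^2 = eps^(2-d) for d = 2 - 2/(1+m), the dimension and
the nondegeneracy then follow from [has_box_dim_of_area_bounds] and
[nondegenerate_of_area_bounds].

Upper bound ([spiral_area_le]).  The part of the trajectory with phi > e^(-m) lies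
in a square of side of order e.  The length of the remaining part is controlled by
phi^(1-1/m) ([orbit_variation]), hence is of order e^(1-m); it is covered by
e^(1-m)/eps squares of side of order eps, whose total area is of order
e^(1-m) eps = e^2.

Lower bound ([spiral_area_ge]).  Between two successive passages of a ray w grows
by 4 pi k, so at distance r from the origin consecutive turns are at distance of
order r^(m+1) ([orbit_near_point]).  For r a small multiple of e this is less than
eps, so the neighbourhood contains a square of side of order e.

Backward trajectories are treated as forward ones of the system multiplied by
dl = -1. *)

(** * Area in the plane *)

Section PlaneArea.
Context {R : realType}.
Implicit Types (A U : set (R * R)) (a c p : R * R).

Definition square c (r : R) : set (R * R) :=
  `[c.1 - r, c.1 + r] `*` `[c.2 - r, c.2 + r].

Lemma measurable_square c r : measurable (square c r).
Proof. exact: measurableX. Qed.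

Lemma area_square c r : 0 <= r -> area (square c r) = ((2 * r) ^+ 2)%:E.
Proof.
move=> r0; rewrite /area product_measure1E//= !lebesgue_measure_itv/= !lte_fin.
have [->|rn0] := eqVneq r 0.
  by rewrite subr0 addr0 subr0 addr0 !ltxx/= mulr0 expr0n/= mule0.
have rp : 0 < r by rewrite lt0r rn0.
have -> : c.1 - r < c.1 + r by lra.
have -> : c.2 - r < c.2 + r by lra.
by rewrite /= -!EFinD -EFinM; congr (_%:E); ring.
Qed.

(** An open set is the union of the squares with rational centre and radius that it
contains, and these are countably many. *)
Lemma open_measurable_plane U : open U -> measurable U.
Proof.
move=> oU.
pose box (q : rat * rat * rat) := square (ratr q.1.1 : R, ratr q.1.2 : R) (ratr q.2 : R).
have -> : U = \bigcup_q (if pselect (box q `<=` U) then box q else set0).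
  apply/seteqP; split; last first.
    by move=> p [q _]; case: pselect => // qU; exact: qU.
  move=> p Up; have /nbhs_ballP[e /= e0 eU] : nbhs p U by exact: open_nbhs_nbhs.
  have e4 : 0 < e / 4 by rewrite divr_gt0.
  have e42 : e / 4 < e / 2 by lra.
  have [r] := rat_in_itvoo e42; rewrite in_itv/= => /andP[r1 r2].
  have e41 (z : R) : z - e / 4 < z by rewrite ltrBlDr ltrDl.
  have [q1] := rat_in_itvoo (e41 p.1); rewrite in_itv/= => /andP[q11 q12].
  have [q2] := rat_in_itvoo (e41 p.2); rewrite in_itv/= => /andP[q21 q22].
  exists (q1, q2, r) => //.
  have pb : box (q1, q2, r) p by split; rewrite /= in_itv/=; apply/andP; split; lra.
  case: pselect => // /=; case=> z [/=]; rewrite !in_itv/= => /andP[z1 z2] /andP[z3 z4].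
  apply: eU; split; rewrite /ball/= ltr_norml; apply/andP; split; lra.
apply: (@countable_bigcupT_measurable _ _ (rat * rat * rat)%type).
  exact: countableP.
move=> q; case: pselect => /= _; last exact: measurable0. by rewrite /box; exact: measurable_square.
Qed.

Lemma neighborhoodP A eps p :
  neighborhood A eps p <-> exists2 a, A a & eucl_dist p a < eps.
Proof.
split=> [/ereal_inf_ltP[_ [a Aa <-]]|[a Aa pa]]; first by exists a.
by apply/ereal_inf_ltP; exists (eucl_dist p a)%:E => //; exists a.
Qed.

Lemma eucl_dist_lt p a eps : 0 < eps ->
  (eucl_dist p a < eps) = ((p.1 - a.1) ^+ 2 + (p.2 - a.2) ^+ 2 < eps ^+ 2).
Proof.
move=> e0; rewrite /eucl_dist /eucl_norm/=.
by rewrite -[X in _ < X]gtr0_norm// -[X in _ < X]sqrtr_sqr ltr_sqrt ?exprn_gt0//.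
Qed.

Lemma open_neighborhood A eps : 0 < eps -> open (neighborhood A eps).
Proof.
move=> e0.
have -> : neighborhood A eps = \bigcup_(a in A)
    ((fun p => (p.1 - a.1) ^+ 2 + (p.2 - a.2) ^+ 2) @^-1` [set z | z < eps ^+ 2]).
  apply/seteqP; split=> p; rewrite neighborhoodP.
    by move=> [a Aa]; rewrite eucl_dist_lt// => ?; exists a.
  by move=> [a Aa] ?; exists a => //; rewrite eucl_dist_lt.
apply: bigcup_open => a Aa; apply: open_comp; last exact: open_lt.
move=> p _; apply: cvgD; rewrite /=.
  apply: (@continuous_comp _ _ _ (fun q : R * R => q.1 - a.1) (fun z => z ^+ 2)).
    by apply: cvgB; [exact: cvg_fst|exact: cvg_cst].
  exact: exprn_continuous.
apply: (@continuous_comp _ _ _ (fun q : R * R => q.2 - a.2) (fun z => z ^+ 2)).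
  by apply: cvgB; [exact: cvg_snd|exact: cvg_cst].
exact: exprn_continuous.
Qed.

Lemma measurable_neighborhood A eps :
  0 < eps -> measurable (neighborhood A eps).
Proof. by move=> e0; apply: open_measurable_plane; exact: open_neighborhood. Qed.

Lemma area_ge0 U : (0 <= area U)%E.
Proof. exact: measure_ge0. Qed.

Lemma area_ge_square U c r : 0 <= r -> measurable U -> square c r `<=` U ->
  (((2 * r) ^+ 2)%:E <= area U)%E.
Proof.
move=> r0 mU cU; rewrite -(area_square c)//.
by apply: le_measure => //; rewrite inE//; exact: measurable_square.
Qed.

Lemma area_le_squares U N (c : nat -> R * R) (r : nat -> R) :
  (forall i, 0 <= r i) -> measurable U ->
  (forall p, U p -> exists2 i, (i < N)%N & square (c i) (r i) p) ->
  (area U <= (\sum_(i < N) (2 * r i) ^+ 2)%:E)%E.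
Proof.
move=> r0 mU Uc.
apply: (@le_trans _ _ (\sum_(i < N) area (square (c i) (r i)))%E).
  apply: (@content_subadditive _ _ _ (lebesgue_measure \x lebesgue_measure)%E U
    (fun i => square (c i) (r i)) N) => //.
    by move=> i _; exact: measurable_square.
  by move=> p /Uc[i iN ip]; rewrite -(bigcup_mkord N (fun j => square (c j) (r j))); exists i.
rewrite -sumEFin; apply: lee_sum => i _.
by rewrite area_square.
Qed.

End PlaneArea.

(** * Box dimension from two-sided area bounds *)

Section BoxDimension.
Context {R : realType}.
Implicit Types (A : set (R * R)) (s d eps : R).

Lemma lower_content_ge s A e1 m : 0 < e1 ->
  (forall eps, 0 < eps < e1 -> (m%:E <= content_ratio s A eps)%E) ->
  (m%:E <= lower_content s A)%E.
Proof.
move=> e10 H; rewrite /lower_content limf_einfE.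
apply: le_ereal_sup_tmp; exists (ereal_inf (content_ratio s A @` [set x | 0 < x < e1])).
  exists [set x | 0 < x < e1] => //=.
  near=> x; apply/andP; split; near: x; first exact: nbhs_right_gt.
  exact: nbhs_right_lt.
by apply/ereal_infP => _ [x x01 <-]; exact: H.
Unshelve. all: by end_near. Qed.

Lemma upper_content_le s A e1 m : 0 < e1 ->
  (forall eps, 0 < eps < e1 -> (content_ratio s A eps <= m%:E)%E) ->
  (upper_content s A <= m%:E)%E.
Proof.
move=> e10 H; rewrite /upper_content limf_esupE.
apply: ge_ereal_inf; exists (ereal_sup (content_ratio s A @` [set x | 0 < x < e1])).
  exists [set x | 0 < x < e1] => //=.
  near=> x; apply/andP; split; near: x; first exact: nbhs_right_gt.
  exact: nbhs_right_lt.
by apply/ereal_supP => _ [x x01 <-]; exact: H.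
Unshelve. all: by end_near. Qed.

Lemma lower_content_le_upper s A : (lower_content s A <= upper_content s A)%E.
Proof.
rewrite /lower_content /upper_content limf_einfE limf_esupE.
apply/ereal_supP => _ [V FV <-]; apply/ereal_infP => _ [W FW <-].
have [x [Vx Wx]] : V `&` W !=set0.
  by apply: (@filter_ex _ (0 : R)^'+); exact: filterI.
apply: (@le_trans _ _ (content_ratio s A x)).
  by apply: ge_ereal_inf; exists (content_ratio s A x) => //; exists x.
by apply: le_ereal_sup_tmp; exists (content_ratio s A x) => //; exists x.
Qed.

Lemma lower_content_ge0 s A : (0 <= lower_content s A)%E.
Proof.
apply: (@lower_content_ge _ _ 1) => // eps /andP[e0 _].
by rewrite /content_ratio mule_ge0 ?area_ge0// inve_ge0 lee_fin powR_ge0.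
Qed.

(** If the area of the eps-neighbourhood lies between two multiples of eps^(2-d), the
ratio that defines the s-content lies between two multiples of eps^(s-d), which
tends to 0 for s > d and is bounded below for s <= d. *)
Section Bounds.
Variables (A : set (R * R)) (d c C e0 : R).
Hypotheses (d0 : 0 <= d) (c0 : 0 < c) (C0 : 0 < C) (e00 : 0 < e0).
Hypothesis bnd : forall eps, 0 < eps < e0 ->
  ((c * eps `^ (2 - d))%:E <= area (neighborhood A eps) <=
   (C * eps `^ (2 - d))%:E)%E.

Lemma content_ratio_bounds s eps : 0 < eps < e0 ->
  ((c * eps `^ (s - d))%:E <= content_ratio s A eps <=
   (C * eps `^ (s - d))%:E)%E.
Proof.
move=> eps0; have /andP[ep _] := eps0.
have ps : 0 < eps `^ (2 - s) by rewrite powR_gt0.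
have -> : eps `^ (s - d) = eps `^ (2 - d) / eps `^ (2 - s).
  rewrite -powRN -powRD ?(gt_eqF ep)/= ?implybT//; congr (_ `^ _); ring.
rewrite /content_ratio inver gt_eqF// !mulrA !EFinM.
rewrite !lee_pmul2r ?lte_fin ?invr_gt0//; exact: bnd.
Qed.

Lemma content_pos s : s <= d -> (0 < lower_content s A)%E.
Proof.
move=> sd; apply: (@lt_le_trans _ _ c%:E); first by rewrite lte_fin.
apply: (@lower_content_ge _ _ (Num.min 1 e0)); first by rewrite lt_min ltr01.
move=> eps /andP[ep]; rewrite lt_min => /andP[e1 e2].
have /(content_ratio_bounds s)/andP[+ _] : 0 < eps < e0 by rewrite ep.
apply: le_trans; rewrite lee_fin ler_peMr ?(ltW c0)//.
have /ger_powR eps_le : 0 < eps <= 1 by rewrite ep ltW.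
by rewrite -[leLHS](powRr0 eps) eps_le// subr_le0.
Qed.

Lemma content_zero s : d < s -> upper_content s A = 0%E.
Proof.
move=> ds; apply/eqP; rewrite eq_le; apply/andP; split; last first.
  exact: le_trans (lower_content_ge0 s A) (lower_content_le_upper s A).
apply/lee_addgt0Pr => y y0; rewrite add0e.
have sd0 : 0 < s - d by rewrite subr_gt0.
(* For eps below this value C eps^(s-d) is less than y. *)
pose e1 := (y / C) `^ (s - d)^-1.
have yC : 0 < y / C by rewrite divr_gt0.
have e10 : 0 < e1 by rewrite powR_gt0.
apply: (@upper_content_le _ _ (Num.min e1 e0)); first by rewrite lt_min e10.
move=> eps /andP[ep]; rewrite lt_min => /andP[h1 h2].
have /(content_ratio_bounds s)/andP[_] : 0 < eps < e0 by rewrite ep.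
move=> /le_trans; apply; rewrite lee_fin mulrC -ler_pdivlMr//.
rewrite -[leRHS]powRr1 ?(ltW yC)// -(mulVf (lt0r_neq0 sd0)) powRrM -/e1.
by apply: ge0_ler_powR; rewrite ?nnegrE ?ltW.
Qed.

Lemma content_critical : (upper_content d A < +oo)%E.
Proof.
apply: (@le_lt_trans _ _ C%:E); last exact: ltry.
apply: (@upper_content_le _ _ e0) => // eps /(content_ratio_bounds d)/andP[_].
by rewrite subrr powRr0 mulr1.
Qed.

Lemma has_box_dim_of_area_bounds : has_box_dim A d.
Proof.
have inf_gt : ereal_inf [set s%:E | s in [set s | d < s]] = d%:E.
  apply/eqP; rewrite eq_le; apply/andP; split.
    apply/lee_addgt0Pr => y y0; apply: ge_ereal_inf.
    by exists (d + y)%:E => //; exists (d + y) => //=; rewrite ltrDl.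
  by apply/ereal_infP => _ [s /= ds <-]; rewrite lee_fin ltW.
split; rewrite -inf_gt; congr ereal_inf; congr (image _ _);
  apply/seteqP; split => s /=.
- move=> [_ ls]; rewrite ltNge; apply/negP => /content_pos.
  by rewrite ls ltxx.
- move=> ds; split; first by rewrite (le_trans d0)// ltW.
  apply/eqP; rewrite eq_le lower_content_ge0 andbT.
  by rewrite -(content_zero ds) lower_content_le_upper.
- move=> [_ ls]; rewrite ltNge; apply/negP => /content_pos.
  by move=> /lt_le_trans/(_ (lower_content_le_upper s A)); rewrite ls ltxx.
- by move=> ds; split; [rewrite (le_trans d0)// ltW|exact: content_zero].
Qed.

Lemma nondegenerate_of_area_bounds : minkowski_nondegenerate A.
Proof.
exists d; split => //; [exact: content_pos|exact: lower_content_le_upper|].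
exact: content_critical.
Qed.

End Bounds.
End BoxDimension.

(** * Calculus on a half-line *)

Section Calculus.
Context {R : realType}.
Implicit Types (f g : R -> R) (t a b : R).

(** The rules of differentiation are stated for explicit lambda terms, so that the
derivative of a composite expression is assembled as a term. *)
Lemma is_derive_addf f g t a b : is_derive t 1 f a -> is_derive t 1 g b ->
  is_derive t 1 (fun s => f s + g s) (a + b).
Proof. by move=> fa gb; exact: is_deriveD. Qed.

Lemma is_derive_oppf f t a : is_derive t 1 f a ->
  is_derive t 1 (fun s => - f s) (- a).
Proof. by move=> fa; exact: is_deriveN. Qed.

Lemma is_derive_mulf f g t a b : is_derive t 1 f a -> is_derive t 1 g b ->
  is_derive t 1 (fun s => f s * g s) (a * g t + f t * b).
Proof.
by move=> fa gb; apply: is_derive_eq; rewrite /GRing.scale/= addrC (mulrC a).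
Qed.

Lemma is_derive_cstf c t : is_derive t 1 (fun=> c : R) 0.
Proof. exact: is_derive_cst. Qed.

Lemma is_derive_compf F f t a b : is_derive (f t) 1 F b -> is_derive t 1 f a ->
  is_derive t 1 (fun s => F (f s)) (b * a).
Proof. by move=> Fb fa; exact: is_derive1_comp. Qed.

Lemma is_derive_expf f n t a : is_derive t 1 f a ->
  is_derive t 1 (fun s => f s ^+ n.+1) (n.+1%:R * f t ^+ n * a).
Proof.
by move=> /(is_deriveX n.+1); rewrite exprfctE.
Qed.

Lemma is_derive_invf f t a : is_derive t 1 f a -> f t != 0 ->
  is_derive t 1 (fun s => (f s)^-1) (- (f t) ^- 2 * a).
Proof. by move=> fa f0; exact: is_deriveV. Qed.

Lemma is_derive_atan_div f g t a b :
  is_derive t 1 f a -> is_derive t 1 g b -> g t != 0 ->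
  is_derive t 1 (fun s => atan (f s / g s))
    ((a * g t - f t * b) / (f t ^+ 2 + g t ^+ 2)).
Proof.
move=> fa gb gt0.
have H := is_derive_compf (is_derive1_atan _)
  (is_derive_mulf fa (is_derive_invf gb gt0)).
apply: (@is_derive_eq _ _ _ _ _ _ _ _ H).
have : 0 < f t ^+ 2 + g t ^+ 2.
  by rewrite ltr_wpDl ?sqr_ge0// exprn_even_gt0.
move=> fg0; field.
by rewrite gt0 /= gt_eqF// addrC.
Qed.

Lemma is_derive_expR_scale (c t : R) : is_derive t 1 (fun s => expR (c * s)) (expR (c * t) * c).
Proof.
have D := is_derive_compf (is_derive_expR (c * t))
  (is_derive_mulf (is_derive_cstf c t) (is_derive_id t (1 : R))).
by apply: (@is_derive_eq _ _ _ _ _ _ _ _ D); rewrite mul0r add0r mulr1.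
Qed.

Lemma norm_atan_le (z : R) : `|atan z| <= pi / 2.
Proof. by rewrite ler_norml (ltW (atan_gtNpi2 z)) (ltW (atan_ltpi2 z)). Qed.

(** The arc cosine gives an angle up to its sign, which the sign of s determines. *)
Lemma unit_vector_angle (c s : R) : c ^+ 2 + s ^+ 2 = 1 ->
  exists b, c = cos b /\ s = sin b.
Proof.
move=> cs1.
have c1 : -1 <= c <= 1.
  rewrite -ler_norml -(@ler_pXn2r _ 2)// ?nnegrE// expr1n real_normK ?num_real//.
  by rewrite -cs1 lerDl sqr_ge0.
have sE : Num.sqrt (1 - c ^+ 2) = `|s|.
  by rewrite -sqrtr_sqr; congr Num.sqrt; rewrite -cs1; ring.
have [s0|s0] := leP 0 s.
  by exists (acos c); rewrite acosK ?in_itv//= sin_acos// sE ger0_norm.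
exists (- acos c); rewrite cosN sinN acosK ?in_itv//= sin_acos// sE.
by rewrite ltr0_norm// opprK.
Qed.

Lemma cos_sin_turns (a : R) (i : int) :
  cos (a + 2 * pi * i%:~R) = cos a /\ sin (a + 2 * pi * i%:~R) = sin a.
Proof.
have nat_turns (b : R) (l : nat) :
    cos (b + 2 * pi * l%:R) = cos b /\ sin (b + 2 * pi * l%:R) = sin b.
  have -> : 2 * pi * l%:R = (pi *+ 2) *+ l :> R by rewrite mulr_natr mulr_natl.
  by rewrite (periodicn (@cosD2pi R)) (periodicn (@sinD2pi R)).
case: i => l; first exact: nat_turns.
have [<- <-] := nat_turns (a + 2 * pi * (Negz l)%:~R) l.+1.
by rewrite NegzE mulrNz mulrN subrK.
Qed.

Section HalfLine.
Variables (f df : R -> R) (t0 : R).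
Hypothesis Hf : forall t, t0 <= t -> is_derive t 1 f (df t).

Lemma continuous_of_is_derive s t : t0 <= s -> {within `[s, t], continuous f}.
Proof.
move=> ts; apply: derivable_within_continuous => z.
rewrite in_itv/= => /andP[sz _].
by have [] := Hf (le_trans ts sz).
Qed.

Lemma increasing_of_derive_ge0 s t : t0 <= s <= t ->
  (forall z, t0 <= z -> 0 <= df z) -> f s <= f t.
Proof.
move=> /andP[ts st] df0; rewrite -subr_ge0.
have [||z] := @MVT_segment _ f df s t st.
- by move=> z; rewrite in_itv/= => /andP[sz _]; apply: Hf; rewrite (le_trans ts)// ltW.
- exact: continuous_of_is_derive.
rewrite in_itv/= => /andP[sz zt] ->.
by rewrite mulr_ge0 ?df0 ?subr_ge0// (le_trans ts).
Qed.

Lemma decreasing_of_derive_le0 s t : t0 <= s <= t ->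
  (forall z, t0 <= z -> df z <= 0) -> f t <= f s.
Proof.
move=> /andP[ts st] df0; rewrite -subr_le0.
have [||z] := @MVT_segment _ f df s t st.
- by move=> z; rewrite in_itv/= => /andP[sz _]; apply: Hf; rewrite (le_trans ts)// ltW.
- exact: continuous_of_is_derive.
rewrite in_itv/= => /andP[sz zt] ->.
by rewrite mulr_le0_ge0 ?df0 ?subr_ge0// (le_trans ts).
Qed.

Lemma constant_of_derive_eq0 t : t0 <= t ->
  (forall z, t0 <= z -> df z = 0) -> f t = f t0.
Proof.
move=> tt df0; apply/eqP; rewrite eq_le.
rewrite decreasing_of_derive_le0 ?lexx//=; last by move=> z /df0->.
by rewrite increasing_of_derive_ge0 ?lexx//=; last by move=> z /df0->.
Qed.

End HalfLine.
End Calculus.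

(** * Trajectories of the system *)

Section Orbit.
Context {R : realType}.
Variables (p j : nat) (sg dl : R) (x y : R -> R) (t0 : R).
Hypotheses (sg2 : sg = 1 \/ sg = -1) (dl2 : dl = 1 \/ dl = -1).

(* Here n = p + 1 and k = j + 1, so that both powers in the system are successors,
   and q is (xy)^(n-1). *)
Let H t := (x t ^+ p.+1) ^+ 2 + (y t ^+ p.+1) ^+ 2.
Let q t := x t ^+ p * y t ^+ p.
Let W t := (H t)^-1 ^+ j.+1.

Hypothesis hx : forall t, t0 <= t ->
  is_derive t 1 x (dl * (- (y t ^+ p * y t ^+ p.+1) + sg * (q t * H t ^+ j.+1) * x t)).
Hypothesis hy : forall t, t0 <= t ->
  is_derive t 1 y (dl * (x t ^+ p * x t ^+ p.+1 + sg * (q t * H t ^+ j.+1) * y t)).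

Let n : R := p.+1%:R.

Lemma is_derive_X t : t0 <= t -> is_derive t 1 (fun s => x s ^+ p.+1)
  (n * dl * q t * (- y t ^+ p.+1 + sg * H t ^+ j.+1 * x t ^+ p.+1)).
Proof.
move=> tt; have D := is_derive_expf p (hx tt).
apply: (@is_derive_eq _ _ _ _ _ _ _ _ D); rewrite /q -/n !exprS; ring.
Qed.

Lemma is_derive_Y t : t0 <= t -> is_derive t 1 (fun s => y s ^+ p.+1)
  (n * dl * q t * (x t ^+ p.+1 + sg * H t ^+ j.+1 * y t ^+ p.+1)).
Proof.
move=> tt; have D := is_derive_expf p (hy tt).
apply: (@is_derive_eq _ _ _ _ _ _ _ _ D); rewrite /q -/n !exprS; ring.
Qed.

Lemma is_derive_H t : t0 <= t ->
  is_derive t 1 H (2 * n * dl * sg * q t * H t ^+ j.+1 * H t).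
Proof.
move=> tt; have D := is_derive_addf (is_derive_expf 1 (is_derive_X tt))
  (is_derive_expf 1 (is_derive_Y tt)).
apply: (@is_derive_eq _ _ _ _ _ _ _ _ D); rewrite !expr1.
rewrite [X in _ = _ * X]/H; ring.
Qed.

Lemma H_ge0 t : 0 <= H t.
Proof. by rewrite addr_ge0// sqr_ge0. Qed.

(** On a bounded trajectory |H'| <= K H, so that exp(K t) H increases and
exp(- K t) H decreases: if H vanishes once, it vanishes identically. *)
Lemma orbit_avoids_origin B : (forall t, t0 <= t -> `|x t| <= B /\ `|y t| <= B) ->
  (exists t1 t2, [/\ t0 <= t1, t0 <= t2 & (x t1, y t1) <> (x t2, y t2)]) ->
  forall t, t0 <= t -> 0 < H t.
Proof.
move=> bnd nc.
have [s ts Hs] : exists2 s, t0 <= s & 0 < H s.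
  apply: contrapT => /forall2NP H0; case: nc => t1 [t2 [t1t0 t2t0]]; apply.
  have xy0 t : t0 <= t -> x t = 0 /\ y t = 0.
    move=> tt; have [//|/negP] := H0 t; rewrite -leNgt => Ht.
    have /eqP : H t = 0 by apply/eqP; rewrite eq_le Ht H_ge0.
    rewrite paddr_eq0 ?sqr_ge0// !expf_eq0/= => /andP[/eqP-> /eqP->] //.
  by have [-> ->] := xy0 _ t1t0; have [-> ->] := xy0 _ t2t0.
have B0 : 0 <= B by have [+ _] := bnd _ ts; exact: le_trans.
pose K := 2 * n * (B ^+ p * B ^+ p * ((B ^+ p.+1) ^+ 2 + (B ^+ p.+1) ^+ 2) ^+ j.+1).
have n0 : 0 <= n by rewrite ler0n.
have bK t : t0 <= t -> `|2 * n * dl * sg * q t * H t ^+ j.+1| <= K.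
  move=> tt; have [bx by_] := bnd _ tt; have H0 := H_ge0 t.
  have -> : `|2 * n * dl * sg * q t * H t ^+ j.+1| =
      2 * n * (`|x t| ^+ p * `|y t| ^+ p * H t ^+ j.+1).
    rewrite !normrM !normrX (ger0_norm H0) (ger0_norm n0) ger0_norm//.
    have -> : `|dl| = 1 by case: dl2 => ->; rewrite ?normrN normr1.
    have -> : `|sg| = 1 by case: sg2 => ->; rewrite ?normrN normr1.
    by rewrite !mulr1 -!mulrA.
  have bX m (z : R) : `|z| <= B -> `|z| ^+ m <= B ^+ m.
    by move=> zB; rewrite lerXn2r ?nnegrE.
  have HB : H t <= (B ^+ p.+1) ^+ 2 + (B ^+ p.+1) ^+ 2.
    rewrite /H -(ger0_norm (sqr_ge0 (x t ^+ p.+1))) -(ger0_norm (sqr_ge0 (y t ^+ p.+1))).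
    by rewrite !normrX lerD// lerXn2r ?nnegrE ?exprn_ge0// bX.
  rewrite /K ler_wpM2l ?mulr_ge0// ler_pM ?mulr_ge0 ?exprn_ge0//.
    by rewrite ler_pM ?exprn_ge0 ?bX.
  by rewrite lerXn2r ?nnegrE ?addr_ge0 ?sqr_ge0.
move=> t tt.
have [st|tls] := leP s t.
  have D z (tz : t0 <= z) := is_derive_mulf (is_derive_H tz) (is_derive_expR_scale K z).
  have stt : t0 <= s <= t by rewrite ts.
  have /(_ _)/Wrap[z tz|] := increasing_of_derive_ge0 D stt.
    have -> : forall u v e : R, u * v * e + v * (e * K) = (K + u) * (v * e) by move=> *; ring.
    rewrite mulr_ge0 ?mulr_ge0 ?H_ge0 ?expR_ge0//.
    by have := bK _ tz; rewrite ler_norml; lra.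
  rewrite -(pmulr_lgt0 _ (expR_gt0 (K * t))) mulrC; apply: lt_le_trans.
  by rewrite mulr_gt0 ?expR_gt0.
have D z (tz : t0 <= z) := is_derive_mulf (is_derive_H tz) (is_derive_expR_scale (- K) z).
have tts : t0 <= t <= s by rewrite tt ltW.
have /(_ _)/Wrap[z tz|] := decreasing_of_derive_le0 D tts.
  have -> : forall u v e : R, u * v * e + v * (e * - K) = - ((K - u) * (v * e)) by move=> *; ring.
  rewrite oppr_le0 mulr_ge0 ?mulr_ge0 ?H_ge0 ?expR_ge0//.
  by have := bK _ tz; rewrite ler_norml; lra.
rewrite -(pmulr_lgt0 _ (expR_gt0 (- K * t))) mulrC; apply: lt_le_trans.
by rewrite mulr_gt0 ?expR_gt0.
Qed.

Hypothesis Hpos : forall t, t0 <= t -> 0 < H t.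

Lemma is_derive_W t : t0 <= t ->
  is_derive t 1 W (- (2 * n * j.+1%:R * dl * sg * q t)).
Proof.
move=> tt; have Hn0 : H t != 0 by rewrite gt_eqF// Hpos.
have D := is_derive_expf j (is_derive_invf (is_derive_H tt) Hn0).
apply: (@is_derive_eq _ _ _ _ _ _ _ _ D); rewrite exprVn (exprS (H t) j).
have : H t ^+ j != 0 by rewrite expf_neq0.
by move: (H t ^+ j) => h h0; field; rewrite Hn0 h0.
Qed.

Lemma W_gt0 t : t0 <= t -> 0 < W t.
Proof. by move=> tt; rewrite exprn_gt0// invr_gt0 Hpos. Qed.

Hypothesis Hlim : forall e, 0 < e -> exists2 t, t0 <= t & H t < e.

Lemma W_unbounded B : exists2 t, t0 <= t & B < W t.
Proof.
have B0 : 0 < 1 + `|B| by rewrite ltr_pwDl.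
have [|t tt Ht] := Hlim (e := (1 + `|B|)^-1); first by rewrite invr_gt0.
have H1 : 1 + `|B| < (H t)^-1 by rewrite -[ltLHS]invrK ltf_pV2 ?posrE ?invr_gt0 ?Hpos.
exists t => //; apply: (@le_lt_trans _ _ (1 + `|B|)).
  by rewrite (le_trans (ler_norm B))// lerDr.
apply: (lt_le_trans H1); apply: ler_eXnr => //.
by rewrite ltW// (le_lt_trans _ H1)// lerDl.
Qed.

(** For odd p both X = x^n and Y = y^n are nonnegative, and pi/4 plus the arc tangent
of (Y - X)/(Y + X) is the angle of (X, Y).  Thus f below is the first integral
w + 2ks phi up to a constant; phi being bounded, w is bounded as well. *)
Lemma focus_exponent_even : ~~ odd p.
Proof.
apply/negP => op.
have ev : ~~ odd p.+1 by rewrite /= op.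
pose f t := W t + 2 * j.+1%:R * sg *
  atan ((y t ^+ p.+1 + - x t ^+ p.+1) / (y t ^+ p.+1 + x t ^+ p.+1)).
have D0 t : t0 <= t -> y t ^+ p.+1 + x t ^+ p.+1 != 0.
  move=> tt; rewrite paddr_eq0 ?exprn_even_ge0//.
  apply/negP => /andP[/eqP y0 /eqP x0]; have := Hpos tt.
  by rewrite /H x0 y0 expr0n/= addr0 ltxx.
have Df t : t0 <= t -> is_derive t 1 f 0.
  move=> tt.
  have DX := is_derive_X tt; have DY := is_derive_Y tt.
  have Da := is_derive_atan_div
    (is_derive_addf DY (is_derive_oppf DX))
    (is_derive_addf DY DX) (D0 _ tt).
  have D := is_derive_addf (is_derive_W tt)
    (is_derive_mulf (is_derive_cstf (2 * j.+1%:R * sg) t) Da).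
  apply: (@is_derive_eq _ _ _ _ _ _ _ _ D); rewrite mul0r add0r.
  have Hn0 : H t != 0 by rewrite gt_eqF// Hpos.
  move: Hn0; rewrite /H; move: (x t ^+ p.+1) (y t ^+ p.+1) => X Y Hn0.
  by field; rewrite /= -/n; apply: contra Hn0 => /eqP h; apply/eqP; lra.
have fb t : t0 <= t -> `|f t - W t| <= 2 * j.+1%:R * pi.
  move=> tt; rewrite /f addrC addKr !normrM.
  have -> : `|sg| = 1 by case: sg2 => ->; rewrite ?normrN normr1.
  rewrite !normr_nat mulr1 ler_wpM2l ?mulr_ge0//.
  by apply: (le_trans (norm_atan_le _)); have := pi_ge0 R; lra.
have [t tt] := W_unbounded (f t0 + 2 * j.+1%:R * pi).
apply/negP; rewrite -leNgt.
have := fb _ tt; rewrite (constant_of_derive_eq0 Df tt)//.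
by rewrite ler_norml; lra.
Qed.

Lemma q_ge0 t : 0 <= q t.
Proof. by rewrite mulr_ge0// exprn_even_ge0// focus_exponent_even. Qed.

(** For even p the function q is nonnegative, and W, being unbounded, cannot be
nonincreasing. *)
Lemma focus_sign : sg = - dl.
Proof.
have [//|dlsg] : sg = - dl \/ dl * sg = 1.
  by case: sg2 => ->; case: dl2 => ->; rewrite ?opprK ?mulrNN ?mulr1; [right|left|left|right].
have [t tt] := W_unbounded (W t0).
rewrite ltNge => /negP; case.
have t0t : t0 <= t0 <= t by rewrite lexx.
apply: (decreasing_of_derive_le0 is_derive_W t0t) => z _.
rewrite oppr_le0 mulr_ge0 ?q_ge0// -mulrA dlsg mulr1.
by rewrite !mulr_ge0// ler0n.
Qed.

Lemma dl_sqr : dl * dl = 1.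
Proof. by case: dl2 => ->; rewrite ?mulrNN mulr1. Qed.

Lemma is_derive_W_focus t : t0 <= t -> is_derive t 1 W (2 * n * j.+1%:R * q t).
Proof.
move=> tt; have D := is_derive_W tt.
apply: (@is_derive_eq _ _ _ _ _ _ _ _ D); rewrite focus_sign.
by rewrite -[in RHS](mulr1 (2 * n * j.+1%:R)) -dl_sqr; ring.
Qed.

Lemma W_nondecreasing s t : t0 <= s <= t -> W s <= W t.
Proof.
move=> /(increasing_of_derive_ge0 is_derive_W_focus); apply => z _.
by rewrite mulr_ge0 ?q_ge0// !mulr_ge0 ?ler0n.
Qed.

(** The polar angle of (x, y), counted in the direction of rotation of the trajectory
and up to an additive constant: W / (2k) is the angle of (X, Y), and the arc tangent
is the difference of the two angles, at most pi/2 in absolute value as the two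
points lie in the same quadrant. *)
Definition angle t := W t / (2 * j.+1%:R) +
  dl * atan ((x t ^+ p.+1 * y t + - (y t ^+ p.+1 * x t)) /
             (x t * x t ^+ p.+1 + y t * y t ^+ p.+1)) + pi / 2.

Lemma is_derive_angle t : t0 <= t ->
  is_derive t 1 angle (H t / (x t ^+ 2 + y t ^+ 2)).
Proof.
move=> tt.
have Hn0 : H t != 0 by rewrite gt_eqF// Hpos.
have r0 : x t ^+ 2 + y t ^+ 2 != 0.
  rewrite paddr_eq0 ?sqr_ge0//; apply: contra Hn0 => /andP[].
  by rewrite !expf_eq0/= /H => /eqP-> /eqP->; rewrite !expr0n/= addr0.
have D0 : x t * x t ^+ p.+1 + y t * y t ^+ p.+1 != 0.
  have ep : ~~ odd p.+2 by rewrite /= negbK focus_exponent_even.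
  rewrite -!exprS paddr_eq0 ?exprn_even_ge0//; apply: contra Hn0 => /andP[].
  by rewrite !expf_eq0/= /H => /eqP-> /eqP->; rewrite !expr0n/= addr0.
have DX := is_derive_X tt; have DY := is_derive_Y tt.
have Da := is_derive_atan_div
  (is_derive_addf (is_derive_mulf DX (hy tt))
                  (is_derive_oppf (is_derive_mulf DY (hx tt))))
  (is_derive_addf (is_derive_mulf (hx tt) DX) (is_derive_mulf (hy tt) DY)) D0.
have D := is_derive_addf (is_derive_addf
  (is_derive_mulf (is_derive_W_focus tt) (is_derive_cstf (2 * j.+1%:R)^-1 t))
  (is_derive_mulf (is_derive_cstf dl t) Da)) (is_derive_cstf (pi / 2) t).
apply: (@is_derive_eq _ _ _ _ _ _ _ _ D).
move: Hn0 r0 D0; rewrite /q focus_sign; move: (H t ^+ j.+1) => h; rewrite /H !(exprS _ p).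
move: (x t) (y t) (x t ^+ p) (y t ^+ p) => u v a b Hn0 r0 D0.
have j0 : (j.+1%:R : R) != 0 by rewrite pnatr_eq0.
(* With z = x + iy and Z = X + iY this is |Z conj(z)|^2 = |Z|^2 |z|^2. *)
have NN : (u * a * v - v * b * u) ^+ 2 + (u * (u * a) + v * (v * b)) ^+ 2 =
   ((u * a) ^+ 2 + (v * b) ^+ 2) * (u ^+ 2 + v ^+ 2) by ring.
rewrite NN -/n.
rewrite -[j.+1]add1n natrD in j0 *.
by case: dl2 => ->; field; rewrite r0 Hn0 j0.
Qed.

Lemma H_W t : t0 <= t -> H t ^+ j.+1 = (W t)^-1.
Proof. by move=> tt; rewrite /W exprVn invrK. Qed.

Lemma angle_bounds t :
  W t / (2 * j.+1%:R) <= angle t <= W t / (2 * j.+1%:R) + pi.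
Proof.
rewrite /angle; set A := atan _; have : `|dl * A| <= pi / 2.
  by rewrite normrM; case: dl2 => ->; rewrite ?normrN normr1 mul1r norm_atan_le.
rewrite ler_norml; move: (dl * A) (W t / _) => z w /andP[A1 A2]; apply/andP; split; lra.
Qed.

Lemma angle_gt0 t : t0 <= t -> 0 < angle t.
Proof.
move=> tt; have /andP[+ _] := angle_bounds t; apply: lt_le_trans.
by rewrite divr_gt0 ?W_gt0// mulr_gt0// ltr0n.
Qed.

(* The sup norm of (x, y), which powers commute with. *)
Let M t := Num.max `|x t| `|y t|.

Lemma radius_gt0 t : t0 <= t -> 0 < M t.
Proof.
move=> tt; rewrite lt_max !normr_gt0 -negb_and; apply: contraTN (Hpos tt).
by rewrite /H => /andP[/eqP-> /eqP->]; rewrite !expr0n/= addr0 ltxx.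
Qed.

Lemma radius_pow_le t : M t ^+ (2 * p.+1) <= H t.
Proof.
have E (z : R) : `|z| ^+ (2 * p.+1) = (z ^+ p.+1) ^+ 2.
  by rewrite mulnC exprM -normrX real_normK ?num_real.
by rewrite /M /H; have [_|_] := leP `|x t| `|y t|; rewrite E ?lerDl ?lerDr sqr_ge0.
Qed.

(** The angle turns with speed H / r^2, and H >= M^(2n) while r^2 <= 2 M^2. *)
Lemma angular_speed_ge t : t0 <= t ->
  M t ^+ (2 * p) / 2 <= H t / (x t ^+ 2 + y t ^+ 2).
Proof.
move=> tt; have M0 := radius_gt0 tt.
have sqM (z : R) : `|z| <= M t -> z ^+ 2 <= M t ^+ 2.
  by move=> zM; rewrite -real_normK ?num_real// lerXn2r ?nnegrE// ltW.
have rM : x t ^+ 2 + y t ^+ 2 <= 2 * M t ^+ 2.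
  by rewrite mulrDl mul1r lerD// sqM// le_max lexx ?orbT.
have r0 : 0 < x t ^+ 2 + y t ^+ 2.
  rewrite lt0r addr_ge0 ?sqr_ge0// andbT paddr_eq0 ?sqr_ge0//.
  apply: contraTN (Hpos tt).
  by rewrite !expf_eq0/= /H => /andP[/eqP-> /eqP->]; rewrite !expr0n/= addr0 ltxx.
rewrite ler_pdivlMr//; apply: le_trans (radius_pow_le t).
rewrite mulnS addnC exprD mulrAC ler_pdivrMr// -mulrA ler_pM2l ?exprn_gt0//.
by rewrite mulrC.
Qed.

Let c0 := 2 * (1 + (W t0)^-1).

(** A velocity is at most a multiple of the radius times the angular velocity: the
rotational part of the field is at most M^(2n-1), the radial part at most 1 / W times
that, and W does not fall below its initial value.  The parameters s1 and s2 cover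
both components of the field. *)
Lemma speed_le (u v : R -> R) (s1 s2 t : R) : t0 <= t ->
  `|u t| <= M t -> `|v t| <= M t -> `|s1| <= 1 -> `|s2| <= 1 ->
  `|dl * (s1 * (v t ^+ p * v t ^+ p.+1) + s2 * (q t * H t ^+ j.+1) * u t)| <=
  c0 * (M t * (H t / (x t ^+ 2 + y t ^+ 2))).
Proof.
move=> tt uM vM s11 s21; have M0 := radius_gt0 tt.
have -> : forall z, `|dl * z| = `|z|.
  by move=> z; rewrite normrM; case: dl2 => ->; rewrite ?normrN normr1 mul1r.
apply: (@le_trans _ _ ((1 + (W t0)^-1) * M t ^+ (2 * p).+1)); last first.
  have W0 : 0 < 1 + (W t0)^-1 by rewrite addr_gt0 ?invr_gt0 ?W_gt0.
  rewrite /c0 (mulrC 2) -mulrA ler_pM2l// exprS mulrCA ler_pM2l// mulrC -ler_pdivrMr//.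
  exact: angular_speed_ge.
have powM m (z : R) : `|z| <= M t -> `|z ^+ m| <= M t ^+ m.
  by move=> zM; rewrite normrX lerXn2r ?nnegrE// ltW.
have xM : `|x t| <= M t by rewrite le_max lexx.
have yM : `|y t| <= M t by rewrite le_max lexx orbT.
have E : M t ^+ (2 * p).+1 = M t ^+ p * M t ^+ p * M t.
  by rewrite mul2n -addnn exprSr exprD.
rewrite mulrDl mul1r; apply: (le_trans (ler_normD _ _)); apply: lerD.
  rewrite normrM; apply: (le_trans (ler_piMl (normr_ge0 _) s11)).
  rewrite normrM E -mulrA -exprSr.
  by rewrite ler_pM ?powM.
rewrite normrM E [leRHS]mulrA; apply: ler_pM => //.
rewrite normrM; apply: (le_trans (ler_piMl (normr_ge0 _) s21)).
rewrite normrM mulrC H_W//; apply: ler_pM => //.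
  rewrite gtr0_norm ?invr_gt0 ?W_gt0// lef_pV2 ?posrE ?W_gt0//.
  by apply: W_nondecreasing; rewrite lexx.
by rewrite /q normrM ler_pM ?powM.
Qed.

Let m := (2 * p.+1 * j.+1)%N.
Let m0 : (0 < m)%N. Proof. by rewrite !muln_gt0. Qed.
(* In terms of u the radius is of order 1 / u, and the length of order u^(m-1). *)
Let u t := angle t `^ (m%:R^-1).

Lemma u_gt0 t : t0 <= t -> 0 < u t.
Proof. by move=> tt; rewrite powR_gt0// angle_gt0. Qed.

Lemma u_pow t : t0 <= t -> u t ^+ m = angle t.
Proof.
move=> tt; rewrite -powR_mulrn ?powR_ge0// /u -powRrM mulVf ?pnatr_eq0 -?lt0n//.
by rewrite powRr1// ltW// angle_gt0.
Qed.

Let c1 := 1 + ((2 * j.+1%:R)^-1 + pi / W t0).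

(** M^m <= H^k = 1 / W, and W is at least a fixed multiple of the angle u^m.  The m-th
root of the resulting constant is avoided by enlarging the constant by 1. *)
Lemma radius_decay t : t0 <= t -> M t * u t <= c1.
Proof.
move=> tt; have u0 := u_gt0 tt; have M0 := radius_gt0 tt.
have Wt0 : 0 < W t0 by rewrite W_gt0.
have Wt : 0 < W t by rewrite W_gt0.
have W_le : W t0 <= W t by apply: W_nondecreasing; rewrite lexx.
have k0 : 0 < 2 * (j.+1%:R : R) by rewrite mulr_gt0 ?ltr0n.
have c10 : 0 <= (2 * j.+1%:R)^-1 + pi / W t0.
  by rewrite addr_ge0 ?invr_ge0 ?(ltW k0)// divr_ge0 ?pi_ge0// ltW.
have : (M t * u t) ^+ m <= c1 ^+ m.
  rewrite exprMn u_pow//; apply: (@le_trans _ _ ((W t)^-1 * angle t)).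
    rewrite ler_wpM2r ?(ltW (angle_gt0 tt))// -H_W// /m exprM lerXn2r ?nnegrE//.
    - by rewrite exprn_ge0// ltW.
    - exact: H_ge0.
    - exact: radius_pow_le.
  apply: (@le_trans _ _ c1); last first.
    by rewrite ler_eXnr// lerDl.
  have /andP[_ tW] := angle_bounds t.
  rewrite mulrC ler_pdivrMr//; apply: (le_trans tW).
  have piW : pi <= pi / W t0 * W t.
    by rewrite mulrAC ler_pdivlMr// ler_wpM2l ?pi_ge0.
  have -> : c1 * W t = W t + (W t / (2 * j.+1%:R) + pi / W t0 * W t).
    by rewrite /c1; ring.
  by rewrite -[leLHS]add0r lerD ?lerD2l// ltW.
by rewrite ler_pXn2r// nnegrE ?mulr_ge0 ?ltW// ltr_pwDl.
Qed.

Lemma angle_powR t : t0 <= t -> angle t `^ (1 - m%:R^-1) = u t ^+ m.-1.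
Proof.
move=> tt; have t0' : angle t != 0 by rewrite gt_eqF ?angle_gt0.
rewrite powRB ?t0' ?implybT// powRr1 ?(ltW (angle_gt0 tt))// -/(u t) -(u_pow tt).
by rewrite -[in X in X / _](prednK m0) exprSr mulfK// gt_eqF ?u_gt0.
Qed.

Lemma is_derive_angle_powR t : t0 <= t -> is_derive t 1 (fun s => angle s `^ (1 - m%:R^-1))
  ((1 - m%:R^-1) / u t * (H t / (x t ^+ 2 + y t ^+ 2))).
Proof.
move=> tt; have D := is_derive_compf
  (is_derive1_powR (1 - m%:R^-1) (angle_gt0 tt)) (is_derive_angle tt).
apply: (@is_derive_eq _ _ _ _ _ _ _ _ D); congr (_ * _ * _).
by rewrite addrAC subrr add0r powRN.
Qed.

Let K := 2 * c0 * c1.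

Lemma c0_gt0 : 0 < c0.
Proof. by rewrite mulr_gt0// addr_gt0// invr_gt0 W_gt0. Qed.

Lemma c1_gt0 : 0 < c1.
Proof.
by rewrite ltr_pwDl// addr_ge0 ?divr_ge0 ?pi_ge0 ?(ltW (W_gt0 _)) ?invr_ge0 ?mulr_ge0.
Qed.

(** The variation of a function of speed at most c0 M angle' is controlled by the
integral of angle' / u = angle^(-1/m) angle', a multiple of u^(m-1). *)
Lemma variation_le (z dz : R -> R) (s t : R) :
  (forall r, t0 <= r -> is_derive r 1 z (dz r)) ->
  (forall r, t0 <= r -> `|dz r| <= c0 * (M r * (H r / (x r ^+ 2 + y r ^+ 2)))) ->
  t0 <= s <= t -> `|z t - z s| <= K * (u t ^+ m.-1 - u s ^+ m.-1).
Proof.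
move=> Hz dzc st; have /andP[ts sst] := st; have tt := le_trans ts sst.
have dzK r : t0 <= r ->
    `|dz r| <= K * ((1 - m%:R^-1) / u r * (H r / (x r ^+ 2 + y r ^+ 2))).
  move=> tr; apply: (le_trans (dzc _ tr)); have u0 := u_gt0 tr.
  have ta : 0 <= H r / (x r ^+ 2 + y r ^+ 2).
    by rewrite divr_ge0 ?H_ge0// addr_ge0 ?sqr_ge0.
  move: (H r / _) ta => T ta; rewrite /K.
  have -> : 2 * c0 * c1 * ((1 - m%:R^-1) / u r * T) =
      c0 * (c1 * ((1 - m%:R^-1) * 2) / u r * T).
    by move: (u r)^-1 (m%:R^-1) c0 c1 => ????; ring.
  rewrite ler_pM2l ?c0_gt0// ler_wpM2r//.
  have Mc : M r <= c1 / u r by rewrite ler_pdivlMr// radius_decay.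
  apply: (le_trans Mc); rewrite ler_wpM2r ?invr_ge0 ?(ltW u0)//.
  rewrite ler_peMr ?(ltW c1_gt0)//.
  (* The factor 2 in K makes up for 1 - 1/m >= 1/2. *)
have m2 : 2 <= m%:R :> R by rewrite ler_nat /m -mulnA leq_pmulr// muln_gt0.
  have : (m%:R : R)^-1 <= 2^-1 by rewrite lef_pV2// posrE ltr0n.
  lra.
have D1 r (tr : t0 <= r) := is_derive_addf
  (is_derive_mulf (is_derive_cstf K r) (is_derive_angle_powR tr)) (is_derive_oppf (Hz r tr)).
have D2 r (tr : t0 <= r) := is_derive_addf
  (is_derive_mulf (is_derive_cstf K r) (is_derive_angle_powR tr)) (Hz r tr).
have := increasing_of_derive_ge0 D1 st; have := increasing_of_derive_ge0 D2 st.
rewrite !angle_powR// => I1 I2; rewrite ler_norml; apply/andP; split.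
  have /I1 : forall r, t0 <= r -> 0 <= 0 * angle r `^ (1 - m%:R^-1) +
     K * ((1 - m%:R^-1) / u r * (H r / (x r ^+ 2 + y r ^+ 2))) + dz r.
    move=> r /dzK; rewrite mul0r add0r ler_norml => /andP[+ _].
    by rewrite -subr_ge0 opprK addrC.
  lra.
have /I2 : forall r, t0 <= r -> 0 <= 0 * angle r `^ (1 - m%:R^-1) +
   K * ((1 - m%:R^-1) / u r * (H r / (x r ^+ 2 + y r ^+ 2))) - dz r.
  by move=> r /dzK; rewrite mul0r add0r ler_norml subr_ge0 => /andP[_ +].
lra.
Qed.

(** What the covering argument needs to know of a trajectory: its length and its
distance to the origin in terms of one positive parameter v. *)
Lemma orbit_variation : exists (v : R -> R) (K c : R),
  [/\ 0 < K, 0 < c, forall t, t0 <= t -> 0 < v t,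
      forall s t, t0 <= s <= t ->
        `|x t - x s| <= K * (v t ^+ m.-1 - v s ^+ m.-1) /\
        `|y t - y s| <= K * (v t ^+ m.-1 - v s ^+ m.-1)
    & forall t, t0 <= t -> `|x t| * v t <= c /\ `|y t| * v t <= c].
Proof.
exists u, K, c1; split.
- apply: mulr_gt0 c1_gt0; by apply: mulr_gt0 c0_gt0.
- exact: c1_gt0.
- exact: u_gt0.
- have xM r : `|x r| <= M r by rewrite le_max lexx.
  have yM r : `|y r| <= M r by rewrite le_max lexx orbT.
  have sg1 : `|sg| <= 1 by case: sg2 => ->; rewrite ?normrN normr1.
  move=> s t st; split.
    apply: (variation_le hx) => // r tr.
    have := @speed_le x y (-1) sg r tr (xM r) (yM r) _ sg1.
    by rewrite mulN1r; apply; rewrite normrN normr1.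
  apply: (variation_le hy) => // r tr.
  have := @speed_le y x 1 sg r tr (yM r) (xM r) _ sg1.
  by rewrite mul1r; apply; rewrite normr1.
- move=> t tt; have u0 := u_gt0 tt; split; apply: le_trans (radius_decay tt);
    by rewrite ler_pM2r// le_max lexx ?orbT.
Qed.

(* The angle of (X, Y) up to an additive constant. *)
Let psi t := dl * W t / (2 * j.+1%:R).
Let G t := (Num.sqrt (H t))^-1.

Lemma is_derive_psi t : t0 <= t -> is_derive t 1 psi (n * dl * q t).
Proof.
move=> tt; have D := is_derive_mulf
  (is_derive_mulf (is_derive_cstf dl t) (is_derive_W_focus tt))
  (is_derive_cstf (2 * j.+1%:R)^-1 t).
apply: (@is_derive_eq _ _ _ _ _ _ _ _ D).
have j0 : (j.+1%:R : R) != 0 by rewrite pnatr_eq0.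
by rewrite -[j.+1]add1n natrD in j0 *; field.
Qed.

Lemma is_derive_G t : t0 <= t ->
  is_derive t 1 G (- (n * dl * sg * q t * H t ^+ j.+1) * G t).
Proof.
move=> tt; have h0 := Hpos tt; have s0 : Num.sqrt (H t) != 0 by rewrite gt_eqF ?sqrtr_gt0.
have D := is_derive_invf (is_derive_compf (is_derive1_sqrt h0) (is_derive_H tt)) s0.
apply: (@is_derive_eq _ _ _ _ _ _ _ _ D); rewrite /G.
have := sqr_sqrtr (ltW h0); move: (H t ^+ j.+1) => hj.
move: (Num.sqrt (H t)) s0 => s s0 <-; by field.
Qed.

(** The vector (X, Y) / sqrt H rotated back by psi is constant, as its derivative
vanishes. *)
Lemma polar_form : exists b, forall t, t0 <= t ->
  x t ^+ p.+1 = Num.sqrt (H t) * cos (b + psi t) /\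
  y t ^+ p.+1 = Num.sqrt (H t) * sin (b + psi t).
Proof.
have rot t (tt : t0 <= t) :=
  conj (is_derive_compf (is_derive_cos (psi t)) (is_derive_psi tt))
       (is_derive_compf (is_derive_sin (psi t)) (is_derive_psi tt)).
have DA t (tt : t0 <= t) := is_derive_mulf (is_derive_addf
    (is_derive_mulf (is_derive_X tt) (proj1 (rot t tt)))
    (is_derive_mulf (is_derive_Y tt) (proj2 (rot t tt)))) (is_derive_G tt).
have DB t (tt : t0 <= t) := is_derive_mulf (is_derive_addf
    (is_derive_mulf (is_derive_Y tt) (proj1 (rot t tt)))
    (is_derive_oppf (is_derive_mulf (is_derive_X tt) (proj2 (rot t tt))))) (is_derive_G tt).
have cA t (tt : t0 <= t) := constant_of_derive_eq0 DA tt.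
have cB t (tt : t0 <= t) := constant_of_derive_eq0 DB tt.
have {}cA t (tt : t0 <= t) := cA t tt (fun z _ => ltac:(ring)).
have {}cB t (tt : t0 <= t) := cB t tt (fun z _ => ltac:(ring)).
move: cA cB; set A := (_ * G t0); set B := (_ * G t0) => cA cB.
have AB1 : A ^+ 2 + B ^+ 2 = 1.
  have GH : G t0 ^+ 2 * H t0 = 1.
    by rewrite /G exprVn sqr_sqrtr ?H_ge0// mulVf// gt_eqF ?Hpos.
  have cs := cos2Dsin2 (psi t0).
  rewrite -[RHS]GH -[RHS]mulr1 -[in RHS]cs /A /B /H; ring.
have [b [cb sb]] := unit_vector_angle AB1.
exists b => t tt; rewrite cosD sinD -cb -sb -(cB t tt) -(cA t tt).
have sG : Num.sqrt (H t) * G t = 1 by rewrite mulfV// gt_eqF// sqrtr_gt0 Hpos.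
have cs := cos2Dsin2 (psi t).
by split; rewrite -[LHS]mulr1 -[in LHS]sG -[LHS]mulr1 -[in LHS]cs; ring.
Qed.

(** W takes all values above its initial value, and (X, Y) has direction b whenever W is
in a certain arithmetic progression of step 4 pi k. *)
Lemma orbit_hits_direction (b w1 : R) : W t0 <= w1 -> exists t,
  [/\ t0 <= t, w1 <= W t <= w1 + 4 * pi * j.+1%:R,
      x t ^+ p.+1 = Num.sqrt (H t) * cos b & y t ^+ p.+1 = Num.sqrt (H t) * sin b].
Proof.
move=> w01; have [b0 pol] := polar_form.
have k0 : 0 < (j.+1%:R : R) by rewrite ltr0n.
have T0 : 0 < 4 * pi * (j.+1%:R : R) by rewrite !mulr_gt0 ?pi_gt0.
pose base := 2 * j.+1%:R * dl * (b - b0).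
pose i := Num.ceil ((w1 - base) / (4 * pi * j.+1%:R)).
pose w := base + 4 * pi * j.+1%:R * i%:~R.
have w1w : w1 <= w.
  rewrite /w -lerBlDl mulrC -ler_pdivrMr//; exact: Num.Theory.ceil_ge.
have ww1 : w <= w1 + 4 * pi * j.+1%:R.
  have := ltW (Num.Theory.ceilB1_lt ((w1 - base) / (4 * pi * j.+1%:R))).
  by rewrite -/i intrB ler_pdivlMr// mulrC /w; lra.
have [T tT wT] := W_unbounded w.
have [||t] := @IVT _ W t0 T w tT.
- exact: (continuous_of_is_derive is_derive_W).
- have W0T : W t0 <= W T by apply: W_nondecreasing; rewrite lexx.
  by rewrite min_l// max_r// (le_trans w01 w1w) ltW.
rewrite in_itv/= => /andP[tt _] Wt.
exists t; rewrite Wt w1w ww1; have [-> ->] := pol t tt.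
have -> : b0 + psi t = b + 2 * pi * (if dl == 1 then i else - i)%:~R.
  rewrite /psi Wt /w /base.
  have kn0 : (j.+1%:R : R) != 0 by rewrite gt_eqF.
  rewrite -[j.+1]add1n natrD in kn0 *.
  case: dl2 => ->.
    by rewrite eqxx; field.
  by rewrite eqr_oppLR (_ : (1 == - 1 :> R) = false) ?mulrNz; [field|lra].
by have [-> ->] := cos_sin_turns b (if dl == 1 then i else - i).
Qed.

(** On the ray through (a, b) the trajectory passes at r (a, b) with r^m = w1 / w, where
w1 = h^(-k) is the value of W that corresponds to (a, b) itself and w is at most
w1 + 4 pi k.  Then 1 - r <= 1 - r^m = (w - w1) / w <= 4 pi k h^k. *)
Lemma orbit_near_point (a b : R) : 0 < a -> 0 < b ->
  let h := (a ^+ p.+1) ^+ 2 + (b ^+ p.+1) ^+ 2 in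
  W t0 <= h^-1 ^+ j.+1 ->
  exists t, [/\ t0 <= t, `|a - x t| <= a * (4 * pi * j.+1%:R * h ^+ j.+1)
    & `|b - y t| <= b * (4 * pi * j.+1%:R * h ^+ j.+1)].
Proof.
move=> a0 b0 h Wh.
have h0 : 0 < h by rewrite addr_gt0// !exprn_gt0.
pose s := Num.sqrt h; have s0 : 0 < s by rewrite sqrtr_gt0.
have [bt [cb sb]] : exists bt, a ^+ p.+1 / s = cos bt /\ b ^+ p.+1 / s = sin bt.
  apply: unit_vector_angle; rewrite !expr_div_n -mulrDl /s sqr_sqrtr ?ltW//.
  by rewrite -/h mulfV// gt_eqF.
have [t [tt /andP[Wt1 Wt2] Xt Yt]] := orbit_hits_direction bt Wh.
exists t; have sH : 0 < Num.sqrt (H t) by rewrite sqrtr_gt0 Hpos.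
have Wt0 := W_gt0 tt.
have core (c z : R) : 0 < c -> z ^+ p.+1 = Num.sqrt (H t) * (c ^+ p.+1 / s) ->
    `|c - z| <= c * (4 * pi * j.+1%:R * h ^+ j.+1).
  move=> c0' zE.
  have z0 : 0 < z.
    have : 0 < z ^+ p.+1 by rewrite zE mulr_gt0// divr_gt0// exprn_gt0.
    by rewrite exprn_odd_gt0//= focus_exponent_even.
  pose r := z / c; have r0 : 0 < r by rewrite divr_gt0.
  have rE : r ^+ p.+1 = Num.sqrt (H t) / s.
    rewrite expr_div_n zE mulrCA mulrAC mulfV ?mul1r// gt_eqF//.
    exact: exprn_gt0.
  have rm : r ^+ m * W t = h^-1 ^+ j.+1.
    (* r^m = (r^n)^(2k) = (H t / h)^k *)
    rewrite /m (mulnC 2%N) exprM exprM rE expr_div_n !sqr_sqrtr ?ltW ?Hpos//.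
    by rewrite -/h exprMn H_W// mulrAC mulVf ?mul1r// gt_eqF.
  have hW0 : 0 < h^-1 ^+ j.+1 by rewrite exprn_gt0// invr_gt0.
  have r1 : r <= 1.
    by rewrite -(@expr_le1 _ m r) ?m0 ?(ltW r0)// -(ler_pM2r Wt0) rm mul1r.
  have rm_le : r ^+ m <= r by apply: ler_iXnr => //; exact: ltW.
  have -> : c - z = c * (1 - r) by rewrite /r; field; rewrite gt_eqF.
  rewrite normrM (gtr0_norm c0') ler_pM2l// ger0_norm ?subr_ge0//.
  apply: (@le_trans _ _ (1 - r ^+ m)); first by rewrite lerD2l lerN2.
  rewrite -[h]invrK exprVn ler_pdivlMr//.
  apply: (@le_trans _ _ ((1 - r ^+ m) * W t)); last by rewrite mulrBl mul1r rm lerBlDl.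
  by rewrite ler_wpM2l// subr_ge0 exprn_ile1// ltW.
by split => //; apply: core; rewrite ?cb ?sb.
Qed.

End Orbit.

(** * Covering the neighbourhood of a spiral *)

Section Covering.
Context {R : realType}.

Lemma neighborhood_coord (A : set (R * R)) (eps : R) p : 0 < eps ->
  neighborhood A eps p ->
  exists2 a, A a & `|p.1 - a.1| <= eps /\ `|p.2 - a.2| <= eps.
Proof.
move=> e0 /neighborhoodP[a Aa]; rewrite eucl_dist_lt// => pa; exists a => //.
have sq (z : R) : z ^+ 2 <= eps ^+ 2 -> `|z| <= eps.
  move=> ze; rewrite -(@ler_pXn2r _ 2)// ?nnegrE// ?(ltW e0)//.
  by rewrite real_normK ?num_real.
by split; apply: sq; rewrite (le_trans _ (ltW pa))// ?lerDl ?lerDr sqr_ge0.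
Qed.

Definition curve (x y : R -> R) (t0 : R) : set (R * R) :=
  [set (x t, y t) | t in [set t | t0 <= t]].

(** Times are grouped by the integer part of K v^m / eps: points of the curve in the same
group are at distance at most eps, so each group is covered by one square.  Only
times with v <= 1 / e are treated in this way; the other points are covered by one
square around the origin. *)
Lemma spiral_area_le (m : nat) (x y v : R -> R) (t0 K c : R) :
  0 < K -> 0 < c -> (forall t, t0 <= t -> 0 < v t) ->
  (forall s t, t0 <= s <= t ->
    `|x t - x s| <= K * (v t ^+ m - v s ^+ m) /\
    `|y t - y s| <= K * (v t ^+ m - v s ^+ m)) ->
  (forall t, t0 <= t -> `|x t| * v t <= c /\ `|y t| * v t <= c) ->
  exists2 C, 0 < C & forall e, 0 < e <= 1 ->
    (area (neighborhood (curve x y t0) (e ^+ m.+2))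
     <= (C * e ^+ 2)%:E)%E.
Proof.
move=> K0 c0 v0 var decay.
exists (16 * (K + 1) + 4 * (c + 1) ^+ 2) => [|e /andP[e0 e1]].
  by rewrite addr_gt0// mulr_gt0 ?exprn_gt0 ?addr_gt0.
set eps := e ^+ m.+2; have ep : 0 < eps by rewrite exprn_gt0.
pose idx t := Num.truncn (K * v t ^+ m / eps).
have idx0 t : t0 <= t -> 0 <= K * v t ^+ m / eps.
  by move=> tt; rewrite divr_ge0 ?(ltW ep)// mulr_ge0 ?(ltW K0)// exprn_ge0// ltW ?v0.
have close s t : t0 <= s -> t0 <= t -> idx s = idx t ->
    `|x t - x s| <= eps /\ `|y t - y s| <= eps.
  wlog st : s t / s <= t.
    move=> W ts tt st; have [|/ltW] := leP s t => h; first exact: W.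
    by rewrite distrC (distrC (y t)); exact: W.
  move=> ts tt ist; have /var : t0 <= s <= t by rewrite ts.
  suff h : K * (v t ^+ m - v s ^+ m) <= eps.
    by move=> [hx hy]; split; [exact: le_trans hx h|exact: le_trans hy h].
  have /andP[_ h1] := truncn_itv (idx0 _ tt).
  have /andP[h2 _] := truncn_itv (idx0 _ ts).
  rewrite -/(idx t) in h1; rewrite -/(idx s) ist in h2.
  rewrite -[leRHS]mul1r -ler_pdivrMr// mulrBr mulrBl.
  by move: h1; rewrite -natr1; lra.
(* A time in the i-th group, if there is one. *)
pose rep i := xget t0 [set t | t0 <= t /\ idx t = i].
have repP t : t0 <= t -> t0 <= rep (idx t) /\ idx (rep (idx t)) = idx t.
  by move=> tt; apply: (@xgetPex _ t0 [set s | t0 <= s /\ idx s = idx t]); exists t.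
(* A bound of K v^m / eps for v <= 1 / e. *)
pose B := K * (e^-1) ^+ m / eps.
have B0 : 0 <= B.
  by rewrite divr_ge0 ?(ltW ep)// mulr_ge0 ?(ltW K0)// exprn_ge0// invr_ge0 ltW.
pose N := (Num.truncn B).+1.
pose ctr i := if (i < N)%N then (x (rep i), y (rep i)) else (0, 0).
pose rad i := if (i < N)%N then 2 * eps else c * e + eps.
apply: (@le_trans _ _ (\sum_(i < N.+1) (2 * rad i) ^+ 2)%:E).
  apply: (area_le_squares (c := ctr)).
  - move=> i; rewrite /rad; case: ifP => _; first by rewrite mulr_ge0// ltW.
    by apply: addr_ge0; [apply: mulr_ge0|]; exact: ltW.
  - exact: measurable_neighborhood.
  move=> p /(neighborhood_coord ep)[_ [t tt <-]]/= [p1 p2].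
  have vt := v0 _ tt; have [ve|ve] := leP (v t) e^-1.
    have iN : (idx t < N)%N.
      rewrite ltnS le_truncn// /B ler_pM2r ?invr_gt0// ler_pM2l//.
      by rewrite lerXn2r ?nnegrE ?invr_ge0 ?(ltW vt) ?(ltW e0).
    exists (idx t); first exact: ltnW.
    have [r1 r2] := repP _ tt; have [q1 q2] := close _ _ r1 tt r2.
    rewrite /ctr /rad iN; move: p1 p2 q1 q2; rewrite !ler_norml.
    move=> /andP[? ?] /andP[? ?] /andP[? ?] /andP[? ?].
    by split; rewrite /= in_itv/=; apply/andP; split; lra.
  exists N => //; rewrite /ctr /rad ltnn.
  have small z : `|z| * v t <= c -> `|z| <= c * e.
    move=> zc; rewrite -[e]invrK ler_pdivlMr ?invr_gt0//.
    by apply: le_trans zc; rewrite ler_wpM2l// ltW.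
  have [/small + /small] := decay _ tt; move: p1 p2; rewrite !ler_norml.
  move=> /andP[? ?] /andP[? ?] /andP[? ?] /andP[? ?].
  by split; rewrite /= in_itv/=; apply/andP; split; lra.
rewrite lee_fin big_ord_recr/= [leRHS]mulrDl; apply: lerD.
  rewrite (eq_bigr (fun=> (4 * eps) ^+ 2)); last first.
    by move=> i _; rewrite /rad ltn_ord mulrA -natrM.
  rewrite sumr_const card_ord -[leLHS]mulr_natl exprMn.
  have -> : (4 : R) ^+ 2 = 16 by ring.
  rewrite mulrCA -mulrA ler_pM2l//.
  have eps2 : eps ^+ 2 <= e ^+ 2.
    by rewrite lerXn2r ?nnegrE ?(ltW ep) ?(ltW e0)//; apply: ler_iXnr => //; exact: ltW.
  apply: (@le_trans _ _ ((B + 1) * eps ^+ 2)).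
    rewrite ler_wpM2r ?sqr_ge0// /N -natr1 lerD2r.
    by have /andP[] := truncn_itv B0.
  rewrite !mulrDl !mul1r lerD// /B.
  have em : 0 < e ^+ m by rewrite exprn_gt0.
  rewrite exprVn (_ : _ * eps ^+ 2 = K * e ^+ 2)// /eps -[m.+2]addn2 exprD.
  by move: (e ^+ m) em => E E0; field; rewrite !gt_eqF.
rewrite /rad ltnn exprMn (_ : (2 : R) ^+ 2 = 4); last by ring.
have c1 : c * e + eps <= (c + 1) * e.
  by rewrite mulrDl mul1r lerD2l; apply: ler_iXnr => //; exact: ltW.
have ce0 : 0 <= c * e + eps.
  by apply: addr_ge0; [apply: mulr_ge0|]; exact: ltW.
rewrite -mulrA ler_pM2l// -exprMn lerXn2r// nnegrE.
by apply: le_trans c1.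
Qed.

End Covering.

(** * Filling the nucleus of a spiral *)

Section Filling.
Context {R : realType}.

(** If every point of the square [r, 2r]^2 is within L r^(m+1) of the set, then for
r = l e with L l < 1/2 this square is contained in the e^(m+1)-neighbourhood. *)
Lemma spiral_area_ge (m : nat) (Gamma : set (R * R)) (L a0 : R) :
  0 < L -> 0 < a0 ->
  (forall r a b, 0 < r < a0 -> r <= a <= 2 * r -> r <= b <= 2 * r ->
     exists2 p, Gamma p &
       `|a - p.1| <= L * r ^+ m.+1 /\ `|b - p.2| <= L * r ^+ m.+1) ->
  exists2 c, 0 < c & forall e, 0 < e < a0 ->
    ((c * e ^+ 2)%:E <= area (neighborhood Gamma (e ^+ m.+1)))%E.
Proof.
move=> L0 a00 near_pt.
pose l := (2 * L + 2)^-1; have l0 : 0 < l by rewrite invr_gt0 addr_gt0// mulr_gt0.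
have l1 : l <= 1 by rewrite invf_le1 ?addr_gt0 ?mulr_gt0//; lra.
have Ll : L * l < 2^-1.
  by rewrite /l ltr_pdivrMr ?addr_gt0 ?mulr_gt0//; lra.
exists (l ^+ 2) => [|e /andP[e0 ea]]; first exact: exprn_gt0.
have r0 : 0 < l * e by rewrite mulr_gt0.
have ra : 0 < l * e < a0.
  by rewrite r0/= (le_lt_trans _ ea)// ler_piMl// ltW.
have ep : 0 < e ^+ m.+1 by rewrite exprn_gt0.
rewrite -exprMn (_ : l * e = 2 * (l * e / 2)); last by field.
apply: (@area_ge_square _ _ (3 / 2 * (l * e), 3 / 2 * (l * e))).
- by rewrite divr_ge0 ?ltW.
- exact: measurable_neighborhood.
move=> [a b] [/=]; rewrite !in_itv/= => /andP[a1 a2] /andP[b1 b2].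
have [||p Gp [pa pb]] := near_pt _ a b ra; [apply/andP; split; lra..|].
apply/neighborhoodP; exists p => //; rewrite eucl_dist_lt//=.
have Lr : L * (l * e) ^+ m.+1 <= e ^+ m.+1 / 2.
  rewrite exprMn mulrA mulrC ler_pM2l// (le_trans _ (ltW Ll))// ler_pM2l//.
  by apply: ler_iXnr => //; exact: ltW.
have sq (z : R) : `|z| <= L * (l * e) ^+ m.+1 -> z ^+ 2 <= (e ^+ m.+1) ^+ 2 / 4.
  move=> zL; have zl := le_trans zL Lr; rewrite -real_normK ?num_real//.
  have -> : (e ^+ m.+1) ^+ 2 / 4 = (e ^+ m.+1 / 2) ^+ 2 by field.
  by rewrite lerXn2r ?nnegrE// divr_ge0 ?ltW.
apply: (le_lt_trans (lerD (sq _ pa) (sq _ pb))).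
have : 0 < (e ^+ m.+1) ^+ 2 by rewrite exprn_gt0.
lra.
Qed.

End Filling.

Section OrbitDimension.
Context {R : realType}.
Variables (p j : nat) (sg dl : R) (x y : R -> R) (t0 : R).
Hypotheses (sg2 : sg = 1 \/ sg = -1) (dl2 : dl = 1 \/ dl = -1).

Let H t := (x t ^+ p.+1) ^+ 2 + (y t ^+ p.+1) ^+ 2.
Let q t := x t ^+ p * y t ^+ p.

Hypothesis hx : forall t, t0 <= t ->
  is_derive t 1 x (dl * (- (y t ^+ p * y t ^+ p.+1) + sg * (q t * H t ^+ j.+1) * x t)).
Hypothesis hy : forall t, t0 <= t ->
  is_derive t 1 y (dl * (x t ^+ p * x t ^+ p.+1 + sg * (q t * H t ^+ j.+1) * y t)).
Hypothesis bnd : exists B, forall t, t0 <= t -> `|x t| <= B /\ `|y t| <= B.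
Hypothesis nonconstant : exists t1 t2,
  [/\ t0 <= t1, t0 <= t2 & (x t1, y t1) <> (x t2, y t2)].
Hypothesis Hlim : forall e, 0 < e -> exists2 t, t0 <= t & H t < e.

Let m := (2 * p.+1 * j.+1)%N.

(** On the square [r, 2r]^2 the function h^k of [orbit_near_point] is at most Q r^m; the
bound a0 of r ensures that the corresponding value of W is taken. *)
Lemma orbit_near_square : exists L a0, [/\ 0 < L, 0 < a0 &
  forall r a b, 0 < r < a0 -> r <= a <= 2 * r -> r <= b <= 2 * r ->
     exists2 z, curve x y t0 z &
       `|a - z.1| <= L * r ^+ m.+1 /\ `|b - z.2| <= L * r ^+ m.+1].
Proof.
have [B bndB] := bnd.
have Hpos : forall t, t0 <= t -> 0 < H t.
  exact: (orbit_avoids_origin sg2 dl2 hx hy bndB nonconstant).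
have W0 : 0 < (H t0)^-1 ^+ j.+1 by rewrite exprn_gt0// invr_gt0 Hpos.
pose Q : R := 2 ^+ j.+1 * 2 ^+ m; have Q0 : 0 < Q by rewrite mulr_gt0 ?exprn_gt0.
pose P : R := 4 * pi * j.+1%:R.
have P0 : 0 < P by rewrite !mulr_gt0 ?pi_gt0 ?ltr0n.
pose a0 := Num.min 1 (Q * (H t0)^-1 ^+ j.+1)^-1.
have a00 : 0 < a0 by rewrite lt_min ltr01 invr_gt0 mulr_gt0.
exists (2 * (P * Q)), a0; split => // [|r a b]; first by rewrite mulr_gt0// mulr_gt0.
rewrite lt_min => /andP[r0 /andP[r1 rQ]] /andP[a1 a2] /andP[b1 b2].
have ap : 0 < a by exact: lt_le_trans a1.
have bp : 0 < b by exact: lt_le_trans b1.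
pose h := (a ^+ p.+1) ^+ 2 + (b ^+ p.+1) ^+ 2.
have h0 : 0 < h by rewrite addr_gt0// !exprn_gt0.
have hQ : h ^+ j.+1 <= Q * r ^+ m.
  have -> : Q * r ^+ m = (2 * ((2 * r) ^+ p.+1) ^+ 2) ^+ j.+1.
    by rewrite /Q -mulrA -exprMn [RHS]exprMn /m (mulnC 2%N p.+1) !exprM.
  have hb : h <= 2 * ((2 * r) ^+ p.+1) ^+ 2.
    have le2 c : 0 < c -> c <= 2 * r -> (c ^+ p.+1) ^+ 2 <= ((2 * r) ^+ p.+1) ^+ 2.
      move=> c0 cr; have c2 : 0 <= 2 * r by apply: le_trans cr; exact: ltW.
      by rewrite !lerXn2r ?nnegrE ?exprn_ge0// ltW.
    by rewrite mulrDl mul1r lerD// le2.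
  by rewrite lerXn2r ?nnegrE//; [exact: ltW|rewrite mulr_ge0 ?sqr_ge0].
have Wh : (H t0)^-1 ^+ j.+1 <= h^-1 ^+ j.+1.
  rewrite (exprVn h) -[leLHS]invrK lef_pV2 ?posrE ?invr_gt0 ?exprn_gt0 ?invr_gt0 ?Hpos//.
  apply: (le_trans hQ); rewrite -ler_pdivlMl//; apply: (@le_trans _ _ r).
    by apply: ler_iXnr => //; rewrite ?muln_gt0 ?ltW.
  by rewrite -invfM ltW.
have [t [tt xa yb]] :=
  orbit_near_point sg2 dl2 hx hy Hpos Hlim ap bp Wh.
exists (x t, y t); first by exists t.
have est c : r <= c -> c <= 2 * r -> c * (4 * pi * j.+1%:R * h ^+ j.+1) <=
    2 * (P * Q) * r ^+ m.+1.
  move=> rc c2; have -> : 2 * (P * Q) * r ^+ m.+1 = (2 * r) * (P * (Q * r ^+ m)).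
    by rewrite exprS; ring.
  have c0 : 0 <= c by apply: le_trans rc; exact: ltW.
  apply: ler_pM => //; last by rewrite -/P ler_pM2l.
  by apply: mulr_ge0; [exact: ltW|rewrite exprn_ge0 ?ltW].
by split; [exact: le_trans xa (est _ a1 a2)|exact: le_trans yb (est _ b1 b2)].
Qed.

Lemma orbit_dimension : let d := 2 - 2 / (1 + 2 * j.+1%:R * p.+1%:R) in
  has_box_dim (curve x y t0) d /\ minkowski_nondegenerate (curve x y t0).
Proof.
move=> d; have [B bndB] := bnd.
have Hpos : forall t, t0 <= t -> 0 < H t.
  exact: (orbit_avoids_origin sg2 dl2 hx hy bndB nonconstant).
have [v [K [c [K0 c0 v0 var decay]]]] :=
  orbit_variation sg2 dl2 hx hy Hpos Hlim.
have [C C0 up] := spiral_area_le K0 c0 v0 var decay.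
have [L [a0 [L0 a00 near_sq]]] := orbit_near_square.
have [c' c'0 low] := spiral_area_ge L0 a00 near_sq.
pose e1 := Num.min 1 a0; have e10 : 0 < e1 by rewrite lt_min ltr01.
have m0 : (0 < m)%N by rewrite !muln_gt0.
have mE : m%:R = 2 * j.+1%:R * p.+1%:R :> R by rewrite /m !natrM mulrAC.
have d0 : 0 <= d.
  rewrite /d subr_ge0 -mE ler_pdivrMr ?ltr_pwDl// ler_peMr//.
  by rewrite lerDl.
have bounds eps : 0 < eps < e1 ^+ m.+1 ->
    ((c' * eps `^ (2 - d))%:E <= area (neighborhood (curve x y t0) eps) <=
     (C * eps `^ (2 - d))%:E)%E.
  move=> /andP[ep epe].
  (* The scale in which both area bounds are stated: eps = e^(m+1). *)
  pose e := eps `^ (m.+1%:R^-1).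
  have e0 : 0 < e by rewrite powR_gt0.
  have em : e ^+ m.+1 = eps.
    rewrite -powR_mulrn ?powR_ge0// -powRrM mulVf ?pnatr_eq0//.
    by rewrite powRr1// ltW.
  have e2 : eps `^ (2 - d) = e ^+ 2.
    rewrite -powR_mulrn ?powR_ge0// -powRrM; congr (_ `^ _).
    by rewrite /d -mE -natr1; field; rewrite gt_eqF// ltr_wpDl.
  have : e < e1.
    by rewrite -(@ltr_pXn2r _ m.+1) ?nnegrE ?(ltW e0) ?(ltW e10)// em.
  rewrite lt_min => /andP[el1 ela].
  rewrite e2; apply/andP; split.
    by rewrite -em; apply: low; rewrite e0.
  have := up e; rewrite prednK// em; apply.
  by rewrite e0 ltW.
have e1m : 0 < e1 ^+ m.+1 by rewrite exprn_gt0.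
split; first exact: (has_box_dim_of_area_bounds d0 c'0 C0 e1m bounds).
exact: (nondegenerate_of_area_bounds d0 c'0 e1m bounds).
Qed.

End OrbitDimension.

(** * Dimension of spiral trajectories *)

Lemma is_derive_pair {R : realType} (g : R -> R * R) (t : R) (v : R * R) :
  is_derive t 1 g v ->
  is_derive t 1 (fun s => (g s).1) v.1 /\ is_derive t 1 (fun s => (g s).2) v.2.
Proof.
move=> [dg gv].
have cg : h^-1 *: ((g \o shift t) (h *: (1 : R)) - g t) @[h --> 0^'] --> v.
  by rewrite -gv; exact: dg.
have c1 : h^-1 *: (((fun s => (g s).1) \o shift t) (h *: (1 : R)) - (g t).1)
    @[h --> 0^'] --> v.1.
  exact: (cvg_comp _ (@fst R R) cg cvg_fst).
have c2 : h^-1 *: (((fun s => (g s).2) \o shift t) (h *: (1 : R)) - (g t).2)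
    @[h --> 0^'] --> v.2.
  exact: (cvg_comp _ (@snd R R) cg cvg_snd).
by split; split; [exact: cvgP c1|exact: cvg_lim c1|exact: cvgP c2|exact: cvg_lim c2].
Qed.

Lemma trajectory_tends_to_0 {R : realType} (fwd : bool) (t0 : R) (g : R -> R * R) e :
  g @ time_end fwd --> ((0, 0) : R * R) -> 0 < e ->
  exists2 t, half_line fwd t0 t & `|(g t).1| < e /\ `|(g t).2| < e.
Proof.
move=> g0 e0.
have near_e : \forall t \near time_end fwd, ball ((0, 0) : R * R) e (g t).
  exact: (g0 _ (@nbhsx_ballx R (R * R)%type _ _ e0)).
have near_t : \forall t \near time_end fwd, half_line fwd t0 t.
  case: fwd {g0 near_e} => /=.
    by apply: filterS (nbhs_pinfty_ge (num_real t0)) => t; rewrite /= in_itv/= andbT.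
  by apply: filterS (nbhs_ninfty_le (num_real t0)) => t; rewrite /= in_itv.
have PF : ProperFilter (time_end (R := R) fwd) by case: (fwd); exact: _.
have [t [bt tt]] := filter_ex (filterI near_e near_t).
by exists t => //; move: bt => [/=]; rewrite /ball/= !sub0r !normrN.
Qed.

Theorem theorem1 (R : realType) (k n : nat) (sg : bool)
    (hk : (1 <= k)%N) (hn : (1 <= n)%N) (Gamma : set (R * R))
    (hGamma : spiral_trajectory (vector_field k n sg) Gamma) :
  has_box_dim Gamma (2 - 2 / (1 + 2 * k%:R * n%:R)) /\
  minkowski_nondegenerate Gamma.
Proof.
case: k hk hGamma => // j _; case: n hn => // p _.
move=> [_ [fwd [t0 [g [sol [t1 [t2 [ht1 ht2 g12]]] -> bndG [lim _]]]]]].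
(* Time is reversed if the trajectory tends to the origin as t tends to -oo. *)
pose dl : R := if fwd then 1 else -1.
have dlt t : half_line fwd t0 t <-> dl * t0 <= dl * t.
  rewrite /dl; case: (fwd) => /=; rewrite in_itv/= ?andbT ?mul1r//.
  by rewrite !mulN1r lerN2.
have dl2 : dl = 1 \/ dl = -1 by rewrite /dl; case: (fwd); [left|right].
have dlK t : dl * (dl * t) = t by case: dl2 => ->; rewrite ?mul1r// !mulN1r opprK.
have hl t : dl * t0 <= t -> half_line fwd t0 (dl * t) by move=> tt; apply/dlt; rewrite dlK.
pose x t := (g (dl * t)).1; pose y t := (g (dl * t)).2.
have -> : g @` half_line fwd t0 = curve x y (dl * t0).
  apply/seteqP; split=> [_ [t /dlt tt <-]|_ [t /= tt <-]].
    by exists (dl * t) => //; rewrite /x /y !dlK -surjective_pairing.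
  by exists (dl * t); [exact: hl|rewrite /x /y -surjective_pairing].
pose s : R := (-1) ^+ sg.
have s2 : s = 1 \/ s = -1.
  by rewrite /s; case: (sg); rewrite ?expr1 ?expr0; [right|left].
have Dl (t : R) : is_derive t 1 (fun r => dl * r) dl.
  have D := is_derive_mulf (is_derive_cstf dl t) (is_derive_id t (1 : R)).
  by apply: (@is_derive_eq _ _ _ _ _ _ _ _ D); rewrite mul0r add0r mulr1.
have pn : (2 * p.+1 - 1 = p + p.+1)%N by rewrite mul2n -addnn addSn subn1.
have pn1 : (p.+1 - 1 = p)%N by rewrite subn1.
apply: (orbit_dimension s2 dl2).
- move=> t /hl/sol/is_derive_pair[gx _].
  have D := is_derive_compf gx (Dl t).
  apply: (@is_derive_eq _ _ _ _ _ _ _ _ D).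
  rewrite /vector_field/= pn pn1 -/(x t) -/(y t) -/s exprD (mulnC 2%N) !(exprM _ p.+1).
  by rewrite (exprS (x t) p); ring.
- move=> t /hl/sol/is_derive_pair[_ gy].
  have D := is_derive_compf gy (Dl t).
  apply: (@is_derive_eq _ _ _ _ _ _ _ _ D).
  rewrite /vector_field/= pn pn1 -/(x t) -/(y t) -/s exprD (mulnC 2%N) !(exprM _ p.+1).
  by rewrite (exprS (y t) p); ring.
- have [B GB] : exists B, forall z, (g @` half_line fwd t0) z -> `|z| <= B.
    have [B [_ HB]] := bndG; exists (B + 1) => z Gz; apply: (HB _ _ z Gz).
    by rewrite ltrDl.
  exists B => t /hl tt; have := GB (g (dl * t)) (imageP _ tt).
  by rewrite prod_normE /= ge_max => /andP[].
- exists (dl * t1), (dl * t2); split; [exact/dlt|exact/dlt|].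
  by rewrite /x /y !dlK -!surjective_pairing.
- move=> e e0; pose e' := Num.min 1 (e / 2).
  have e'0 : 0 < e' by rewrite lt_min ltr01 divr_gt0.
  have [t /dlt tt [xe ye]] := trajectory_tends_to_0 t0 lim e'0.
  exists (dl * t) => //; rewrite /x /y dlK.
  have small z : `|z| < e' -> (z ^+ p.+1) ^+ 2 < e / 2.
    rewrite lt_min => /andP[z1 ze]; rewrite -real_normK ?num_real// normrX -exprM.
    apply: le_lt_trans ze; apply: ler_iXnr => //.
    exact: ltW.
  by rewrite [ltRHS](splitr e) ltrD ?small.
Qed.
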